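(* Let $G$ be a finite group acting on a finite set $X$, let $g\in G$, and let $k\in\mathbb{Z}_{\ge 0}$, $m\in\mathbb{Z}_{\ge 1}$. Then $$\sum_{\pi\in\operatorname{Irr}G}\frac{(\dim\operatorname{Hom}_G(\pi,\mathbb{C}[X]))^m}{(\dim\pi)^{m+2k-1}}\,\chi_\pi(g)=\frac{1}{(\#G)^{m+2k-1}}\,N_g,$$ where $N_g$ is the number of tuples $(p_1,\dots,p_m,h_1,\dots,h_m,a_1,\dots,a_k,b_1,\dots,b_k)$ with $p_i\in X$, $h_i,a_j,b_j\in G$, $h_i\in G_{p_i}$ for all $i$, and $h_1\cdots h_m\cdot[a_1,b_1]\cdots[a_k,b_k]=g$. Moreover, both sides are equal to $$\frac{1}{(\#G)^{m+2k-1}}\sum_{h_2,\dots,h_m,a_1,\dots,a_k,b_1,\dots,b_k\in G}\#X^{g^{-1}h_2\cdots h_m[a_1,b_1]\cdots[a_k,b_k]}\prod_{i=2}^m\#X^{h_i}.$$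
   Context: $\operatorname{Irr}G$ is the set of isomorphism classes of irreducible complex representations of $G$; $\chi_\pi$ is the character of $\pi$; $\mathbb{C}[X]$ is the space of complex-valued functions on $X$ with the $G$-action $(h f)(x)=f(h^{-1}x)$; $G_p=\{h\in G: hp=p\}$ is the stabilizer of $p\in X$; $X^h=\{x\in X: hx=x\}$; $[a,b]=aba^{-1}b^{-1}$; $\#$ denotes cardinality. Empty products are the identity (or $1$). *)

(* Defs.v *)
From HB Require Import structures.
From mathcomp Require Import all_boot all_order all_fingroup all_algebra.
From mathcomp Require Import mxrepresentation vector reals complex zify.

Set Implicit Arguments.
Unset Strict Implicit.
Unset Printing Implicit Defensive.

Import Order.TTheory GRing.Theory Num.Theory GroupScope.
Local Open Scope ring_scope.

(* The group is the whole type [G : finGroupType], the field of complex numbers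
   is [R[i]] for [R : realType]. *)

(* [fingroup] only defines the commutator x^-1 y^-1 x y. *)
Definition comm_l (G : finGroupType) (a b : G) : G := (a * b * a^-1 * b^-1)%g.

(* MathComp actions are right actions; a left action is encoded by the right
   action [to] such that h x = to x h^-1. *)
Definition lact (G : finGroupType) (X : finType) (to : {action G &-> X})
  (h : G) (x : X) : X := to x h^-1%g.

Lemma lact1 (G : finGroupType) (X : finType) (to : {action G &-> X}) x :
  lact to 1%g x = x.
Proof. by rewrite /lact invg1 act1. Qed.

Lemma lactM (G : finGroupType) (X : finType) (to : {action G &-> X}) g h x :
  lact to (g * h)%g x = lact to g (lact to h x).
Proof. by rewrite /lact invMg actM. Qed.

(* Every left action is of this form. *)
Lemma lactP (G : finGroupType) (X : finType) (act : G -> X -> X) :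
    (forall x, act 1%g x = x) ->
    (forall g h x, act (g * h)%g x = act g (act h x)) ->
  exists to : {action G &-> X}, forall h x, lact to h x = act h x.
Proof.
move=> act_1 act_M; pose f x h := act h^-1%g x.
have f1 x : f x 1%g = x by rewrite /f invg1 act_1.
have fM x : act_morph f x by move=> a b; rewrite /f invMg act_M.
by exists (TotalAction f1 fM) => h x; rewrite /lact /= /f invgK.
Qed.

(* The stabilizer and the fixed points do not depend on the side. *)
Lemma mem_astab1_lact (G : finGroupType) (X : finType) (to : {action G &-> X})
  x h : (h \in 'C[x | to]) = (lact to h x == x).
Proof.
rewrite -groupV; apply/idP/eqP => [/astab1P //|].
by move=> hx; apply/astab1P.
Qed.

Lemma mem_afix1_lact (G : finGroupType) (X : finType) (to : {action G &-> X})
  x h : (x \in 'Fix_to[h]) = (lact to h x == x).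
Proof.
rewrite -mem_astab1_lact; apply/idP/idP => [/afix1P|/astab1P] hx.
  exact/astab1P.
exact/afix1P.
Qed.

(* A set of representatives of the isomorphism classes of irreducible complex
   representations; the representation of index [i] is [irr_repr i]
   (see [rsim_irr_comp_pchar] and [irr_reprK_pchar]). *)
Definition Irr (R : realType) (G : finGroupType) : irrType R[i] [set: G]%G :=
  DecSocleType (regular_repr R[i] [set: G]%G).

Definition rep_dim (R : realType) (G : finGroupType) (pi : Irr R G) : nat :=
  irr_degree pi.

Definition rep_char (R : realType) (G : finGroupType) (pi : Irr R G) (g : G) :
  R[i] := \tr (irr_repr pi g).

(* MathComp representations are homomorphisms G -> GL_n; the left action used
   here is the one on column vectors. MathComp defines irreducibility through
   row vectors; [mx_irreducible_col] transfers it to column vectors. *)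
Definition col_act (R : realType) (G : finGroupType) (n : nat)
    (rG : mx_representation R[i] [set: G]%G n) (h : G) (v : 'cV[R[i]]_n) :
  'cV[R[i]]_n := rG h *m v.

Lemma mx_irreducible_col (R : realType) (G : finGroupType) (n p : nat)
    (rG : mx_representation R[i] [set: G]%G n) (U : 'M[R[i]]_(n, p)) :
    mx_irreducible rG ->
    (forall h : G, ((rG h *m U)^T <= U^T)%MS) ->
  U = 0 \/ \rank U = n.
Proof.
case/mx_irrP=> n_gt0 irrG stU.
have [K0|K0] := eqVneq (kermx U) 0.
  right; apply/eqP; rewrite eqn_leq rank_leq_row /= -subn_eq0 -mxrank_ker.
  by rewrite K0 mxrank0.
left; have /irrG/(_ K0) : mxmodule rG (kermx U).
  apply/mxmoduleP=> h _; apply/sub_kermxP.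
  have /submxP[D /(congr1 trmx)] := stU h.
  rewrite trmxK trmx_mul trmxK -mulmxA => ->.
  by rewrite mulmxA mulmx_ker mul0mx.
rewrite /row_full mxrank_ker => /eqP rk; apply/eqP; rewrite -mxrank_eq0.
by have := rank_leq_row U; lia.
Qed.

Definition fun_act (R : realType) (G : finGroupType) (X : finType)
    (to : {action G &-> X}) (h : G) (f : {ffun X -> R[i]^o}) :
  {ffun X -> R[i]^o} := [ffun x => f (lact to h^-1%g x)].

Definition intertwine (R : realType) (G : finGroupType) (X : finType)
    (to : {action G &-> X}) (n : nat)
    (rG : mx_representation R[i] [set: G]%G n) (h : G)
    (phi : 'Hom('cV[R[i]]_n, {ffun X -> R[i]^o})) :
  'Hom('cV[R[i]]_n, {ffun X -> R[i]^o}) :=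
  ((linfun (fun_act to h) \o phi) - (phi \o linfun (col_act rG h)))%VF.

Definition HomG (R : realType) (G : finGroupType) (X : finType)
    (to : {action G &-> X}) (n : nat)
    (rG : mx_representation R[i] [set: G]%G n) :
  {vspace 'Hom('cV[R[i]]_n, {ffun X -> R[i]^o})} :=
  (\bigcap_(h : G) lker (linfun (intertwine to rG h)))%VS.

(* [linfun] is only meaningful on linear functions. *)
Lemma fun_act_linear (R : realType) (G : finGroupType) (X : finType)
  (to : {action G &-> X}) (h : G) : linear (@fun_act R G X to h).
Proof. by move=> a f1 f2; apply/ffunP=> x; rewrite !ffunE. Qed.

HB.instance Definition _ (R : realType) (G : finGroupType) (X : finType)
    (to : {action G &-> X}) (h : G) :=
  GRing.isLinear.Build _ _ _ _ (@fun_act R G X to h)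
    (@fun_act_linear R G X to h).

Lemma col_act_linear (R : realType) (G : finGroupType) (n : nat)
  (rG : mx_representation R[i] [set: G]%G n) (h : G) : linear (col_act rG h).
Proof. by move=> a v w; rewrite /col_act mulmxDr -scalemxAr. Qed.

HB.instance Definition _ (R : realType) (G : finGroupType) (n : nat)
    (rG : mx_representation R[i] [set: G]%G n) (h : G) :=
  GRing.isLinear.Build _ _ _ _ (col_act rG h) (col_act_linear rG h).

Lemma intertwine_linear (R : realType) (G : finGroupType) (X : finType)
  (to : {action G &-> X}) (n : nat)
  (rG : mx_representation R[i] [set: G]%G n) (h : G) :
  linear (intertwine to rG h).
Proof.
move=> a f1 f2; apply/lfunP=> v; rewrite /intertwine !lfun_simp /=.
by rewrite linearP scalerBr opprD addrACA.
Qed.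

HB.instance Definition _ (R : realType) (G : finGroupType) (X : finType)
    (to : {action G &-> X}) (n : nat)
    (rG : mx_representation R[i] [set: G]%G n) (h : G) :=
  GRing.isLinear.Build _ _ _ _ (intertwine to rG h)
    (intertwine_linear to rG h).

Lemma mem_HomG (R : realType) (G : finGroupType) (X : finType)
    (to : {action G &-> X}) (n : nat)
    (rG : mx_representation R[i] [set: G]%G n)
    (phi : 'Hom('cV[R[i]]_n, {ffun X -> R[i]^o})) :
  phi \in HomG to rG <->
  forall h v, phi (col_act rG h v) = fun_act to h (phi v).
Proof.
rewrite memvE; split=> [/subv_bigcapP sphi h v | phiE].
  have := sphi h isT; rewrite -memvE memv_ker lfunE => /eqP/lfunP/(_ v).
  by rewrite !lfun_simp => /eqP; rewrite subr_eq0 => /eqP ->.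
apply/subv_bigcapP=> h _; rewrite -memvE memv_ker lfunE.
by apply/eqP/lfunP=> v; rewrite !lfun_simp phiE subrr.
Qed.

(* Tuples are functions on ['I_m]: p_1, .., p_m are p 0, .., p (m-1), and so on;
   [\prod] in [%g] multiplies by increasing index. *)
Definition comm_prod (G : finGroupType) (k : nat) (a b : {ffun 'I_k -> G}) : G :=
  (\prod_(j < k) comm_l (a j) (b j))%g.

Definition Ntuples (G : finGroupType) (X : finType) (to : {action G &-> X})
    (g : G) (k m : nat) :
  {set {ffun 'I_m -> X} * {ffun 'I_m -> G} *
       {ffun 'I_k -> G} * {ffun 'I_k -> G}} :=
  [set t : {ffun 'I_m -> X} * {ffun 'I_m -> G} *
           {ffun 'I_k -> G} * {ffun 'I_k -> G} | let: (p, h, a, b) := t in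
     [forall i, h i \in 'C[p i | to]] &&
     ((\prod_(i < m) h i) * comm_prod a b == g)%g].

(* Main.v *)
(* Put F(h) = #X^h. By Schur's lemma, an irreducible pi of dimension n maps the
   central elements sum_h F(h) h^-1 and sum_(a,b) [a,b]^-1 of the group algebra
   to the scalars #G dim Hom_G(pi, C[X]) / n and (#G / n)^2. The dimension
   appears there as the trace (1/#G) sum_h F(h) chi_pi(h^-1) of the projection
   phi |-> (1/#G) sum_h h phi h^-1 onto Hom_G(pi, C[X]). Summing over p first,
   N_g = sum F(h_1) .. F(h_m) over h_1 .. h_m [a_1,b_1] .. [a_k,b_k] = g.
   Detect this equation w = g by the regular character,
   #G [g w^-1 = 1] = sum_pi dim(pi) chi_pi(g w^-1): as pi(w^-1) is a product
   of the above inverses, in reverse order, the sum over the tuples factors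
   into scalars. The last formula eliminates h_1. *)
Require Import Defs.
From HB Require Import structures.
From mathcomp Require Import all_boot all_order all_fingroup all_algebra.
From mathcomp Require Import mxrepresentation vector reals complex ring.

Set Implicit Arguments.
Unset Strict Implicit.
Unset Printing Implicit Defensive.

Import Order.TTheory GRing.Theory Num.Theory GroupScope.
Local Open Scope ring_scope.

(** * Traces of projections *)

(* Both sides are the trace of v |-> \sum_i c i v *: e i, so the left-hand side
   depends only on this endomorphism. *)
Lemma rank_one_trace (K : fieldType) (V : vectType K) (I : finType)
    (c : I -> {linear V -> K^o}) (e : I -> V) :
  \sum_i c i (e i) =
  \sum_k coord (vbasis {:V}) k (\sum_i c i (vbasis {:V})`_k *: e i).
Proof.
under [RHS]eq_bigr => k _ do rewrite linear_sum.
rewrite exchange_big; apply: eq_bigr => i _ /=.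
rewrite {1}(coord_vbasis (memvf (e i))) linear_sum.
by apply: eq_bigr => k _; rewrite !linearZ /= mulrC.
Qed.

(** [P] has two rank-one expansions, one through a basis of [U] and one through the [e i]. Both
    compute its trace, and the first one gives 1 for each basis vector. *)
Lemma dim_projection (K : fieldType) (V : vectType K) (U : {vspace V})
    (P : {linear V -> V}) (I : finType) (c : I -> {linear V -> K^o})
    (e : I -> V) :
    (forall v, P v \in U) -> (forall v, v \in U -> P v = v) ->
    (forall v, v = \sum_i c i v *: e i) ->
  (\dim U)%:R = \sum_i c i (P (e i)).
Proof.
move=> PU idP eE.
have PE v : P v = \sum_i c i v *: P (e i).
  by rewrite {1}(eE v) linear_sum; apply: eq_bigr => i _; rewrite linearZ.
have bE k : coord (vbasis U) k (P (vbasis U)`_k) = 1.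
  rewrite idP ?vbasis_mem ?mem_nth ?size_tuple // coord_free ?eqxx //.
  exact: basis_free (vbasisP U).
pose d k : {linear V -> K^o} := coord (vbasis U) k \o P.
have -> : (\dim U)%:R = \sum_k d k (vbasis U)`_k :> K.
  by rewrite (eq_bigr (fun=> 1)) ?sumr_const ?card_ord // => k _; exact: bE.
rewrite (rank_one_trace d) (rank_one_trace c (fun i => P (e i))).
apply: eq_bigr => k _.
by rewrite -PE /d /= -(coord_vbasis (PU _)).
Qed.

Lemma mxtrace_delta (R : comPzRingType) (n : nat) (i j : 'I_n) :
  \tr (delta_mx i j) = (i == j)%:R :> R.
Proof.
rewrite -(mul_delta_mx (0 : 'I_1)) mxtrace_mulC mul_delta_mx_cond.
by rewrite raddfMn /= trace_mx11 mxE eq_sym.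
Qed.

(** * Sums over tuples *)

Definition ffcons (T : finType) (m : nat) (x : T) (u : {ffun 'I_m -> T}) :
  {ffun 'I_m.+1 -> T} := [ffun i => oapp u x (unlift ord0 i)].

Lemma ffcons0 (T : finType) m x (u : {ffun 'I_m -> T}) : ffcons x u ord0 = x.
Proof. by rewrite ffunE unlift_none. Qed.

Lemma ffconsS (T : finType) m x (u : {ffun 'I_m -> T}) i :
  ffcons x u (lift ord0 i) = u i.
Proof. by rewrite ffunE liftK. Qed.

Lemma sum_ffunS (V : nmodType) (T : finType) (m : nat)
    (F : {ffun 'I_m.+1 -> T} -> V) :
  \sum_t F t = \sum_x \sum_(u : {ffun 'I_m -> T}) F (ffcons x u).
Proof.
rewrite pair_big /= (reindex (fun p => ffcons p.1 p.2)) //.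
exists (fun t : {ffun 'I_m.+1 -> T} =>
  (t ord0, [ffun i : 'I_m => t (lift ord0 i)])) => [[x u] _|t _] /=.
  by rewrite ffcons0; congr pair; apply/ffunP=> i; rewrite ffunE ffconsS.
apply/ffunP=> i; case: (unliftP ord0 i) => [j ->|->]; last by rewrite ffcons0.
by rewrite ffconsS ffunE.
Qed.

Lemma sum_ffun0 (V : nmodType) (T : finType) (F : {ffun 'I_0 -> T} -> V) t :
  \sum_u F u = F t.
Proof.
rewrite (bigD1 t) //= big1 ?addr0 // => u /eqP[].
by apply/ffunP=> -[].
Qed.

(** * Fixed-point counts as class functions *)

Lemma card_afix1V (G : finGroupType) (X : finType) (to : {action G &-> X}) x :
  #|'Fix_to[x^-1%g]| = #|'Fix_to[x]|.
Proof.
by apply: eq_card => y; apply/afix1P/afix1P => e; rewrite -{1}e ?actKV ?actK.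
Qed.

Lemma card_afix1J (G : finGroupType) (X : finType) (to : {action G &-> X}) x y :
  #|'Fix_to[(x ^ y)%g]| = #|'Fix_to[x]|.
Proof.
rewrite -[RHS](card_imset _ (act_inj to y)); apply: eq_card => z.
apply/idP/imsetP.
  move/afix1P => e; exists (to z y^-1%g); last by rewrite actKV.
  apply/afix1P; rewrite -{2}e conjgE -!actM !mulgA; congr (to z _).
  by rewrite mulgK.
by case=> u /afix1P e ->; apply/afix1P; rewrite -actM -conjgC actM e.
Qed.

(** [y * x] is the conjugate of [x * y] by [x]. This is the form of class function that
    [sum_class_repr] takes. *)
Lemma card_afix1C (G : finGroupType) (X : finType) (to : {action G &-> X}) x y :
  #|'Fix_to[(x * y)%g]| = #|'Fix_to[(y * x)%g]|.
Proof. by rewrite -(card_afix1J _ (x * y)%g x) conjgE mulgA mulKg. Qed.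

(** * Group averages in an irreducible representation *)

Section Representation.
Variables (C : numClosedFieldType) (G : finGroupType) (n : nat).
Variable rG : mx_representation C [set: G]%G n.
Hypothesis irrG : mx_irreducible rG.

Local Notation N := #|G|%:R.

Lemma reprM x y : rG (x * y)%g = rG x *m rG y.
Proof. by rewrite repr_mxM ?inE. Qed.

(** Over an algebraically closed field an irreducible representation is absolutely irreducible, so
    its centralizer is scalar; the trace determines the scalar because [n] is nonzero in [C]. *)
Lemma schur A :
  (forall h, A *m rG h = rG h *m A) -> A = (\tr A / n%:R)%:M.
Proof.
move=> cA; have n_gt0 : (0 < n)%N by case/mx_irrP: irrG.
have /is_scalar_mxP[a ->] : is_scalar_mx A.
  apply: (@mx_abs_irr_cent_scalar _ _ _ _ rG).
    exact: group_closure_closed_field.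
  by apply/centgmxP=> h _.
by rewrite mxtrace_scalar -[a *+ n]mulr_natr mulfK // pnatr_eq0 -lt0n.
Qed.

(** The substitution of [x * h] for [h] shows that the sum commutes with every [rG x]; each term has
    trace [\tr M]. *)
Lemma sum_conj_repr M :
  \sum_h rG h *m M *m rG h^-1%g = (N * \tr M / n%:R)%:M.
Proof.
rewrite [LHS]schur => [|x].
  congr (_ / _)%:M; rewrite linear_sum (eq_bigr (fun=> \tr M)) => [|h _].
    by rewrite sumr_const mulr_natl.
  by rewrite /= mxtrace_mulC mulmxA -reprM mulVg repr_mx1 mul1mx.
rewrite mulmx_suml mulmx_sumr (reindex_inj (mulgI x)) /=.
apply: eq_bigr => h _; rewrite -!mulmxA -reprM invMg mulgKV.
by rewrite reprM !mulmxA.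
Qed.

(** Conjugation permutes the terms and preserves [f], so the sum is the image of a central element
    and Schur's lemma applies. *)
Lemma sum_class_repr (f : G -> C) :
    (forall x y, f (x * y)%g = f (y * x)%g) ->
  \sum_h f h *: rG h^-1%g = ((\sum_h f h * \tr (rG h^-1%g)) / n%:R)%:M.
Proof.
move=> fC; rewrite [LHS]schur => [|x].
  congr (_ / _)%:M; rewrite linear_sum.
  by apply: eq_bigr => h _; rewrite linearZ.
rewrite mulmx_suml mulmx_sumr (reindex_inj (conjg_inj x^-1%g)) /=.
apply: eq_bigr => h _; rewrite -scalemxAl -scalemxAr -!reprM conjgE invgK.
by rewrite fC mulgKV !invMg invgK mulgKV.
Qed.

(** Average the conjugates of each matrix unit and read off its own entry: the sum of these entries
    is the left-hand side by definition of the trace, and [n] copies of [N / n] by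
    [sum_conj_repr]. *)
Lemma sum_char_charV : \sum_h \tr (rG h) * \tr (rG h^-1%g) = N.
Proof.
have n_gt0 : (0 < n)%N by case/mx_irrP: irrG.
transitivity (\sum_i \sum_j
    (\sum_h rG h *m delta_mx i j *m rG h^-1%g) i j).
  under [RHS]eq_bigr => i _ do under eq_bigr => j _ do rewrite summxE.
  under [RHS]eq_bigr => i _ do rewrite exchange_big.
  rewrite [RHS]exchange_big; apply: eq_bigr => h _.
  rewrite [LHS]mulr_suml; apply: eq_bigr => i _.
  rewrite [LHS]mulr_sumr; apply: eq_bigr => j _.
  (* The matrix unit is a column times a row, so the entry splits as [rG h i i] times
     [rG h^-1 j j]. *)
  rewrite -(mul_delta_mx (0 : 'I_1)) mulmxA -colE -mulmxA -rowE.
  by rewrite mxE big_ord1 !mxE.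
transitivity (\sum_(i < n) \sum_(j < n) (N / n%:R) *+ (i == j) : C).
  apply: eq_bigr => i _; apply: eq_bigr => j _.
  (* The Kronecker delta occurs twice, from the trace of the matrix unit and from the entry of the
     scalar matrix. *)
  rewrite sum_conj_repr mxE mxtrace_delta mulrAC mulr_natr eq_sym -mulrnA.
  by rewrite mulnb andbb.
rewrite (eq_bigr (fun=> N / n%:R)) => [|i _].
  by rewrite sumr_const card_ord -[_ *+ n]mulr_natr mulfVK ?pnatr_eq0 -?lt0n.
rewrite (bigD1 i) //= eqxx big1 ?addr0 // => j.
by rewrite eq_sym => /negPf ->.
Qed.

(** The inverse commutator is b a b^-1 a^-1. The sum over b averages the conjugates of a and leaves
    a multiple of its character; the sum over a is then that of a class function. *)
Lemma sum_comm_repr :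
  \sum_(p : G * G) rG (comm_l p.1 p.2)^-1%g = ((N / n%:R) ^+ 2)%:M.
Proof.
rewrite -(pair_big predT predT (fun a b => rG (comm_l a b)^-1%g)) /=.
transitivity (N / n%:R *: \sum_a \tr (rG a) *: rG a^-1%g).
  rewrite scaler_sumr; apply: eq_bigr => a _.
  rewrite -mul_scalar_mx scalemxAl scale_scalar_mx mulrAC.
  rewrite -sum_conj_repr mulmx_suml; apply: eq_bigr => b _.
  by rewrite -!reprM /comm_l !invMg !invgK !mulgA.
rewrite sum_class_repr => [|x y]; last by rewrite !reprM mxtrace_mulC.
by rewrite sum_char_charV scale_scalar_mx expr2.
Qed.

(** Inversion reverses the product, so the first entry contributes the rightmost factor, and its sum
    splits off as the scalar [c]. *)
Lemma sum_prod_repr (T : finType) (w : T -> C) (f : T -> G) (c : C) (m : nat) :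
    \sum_t w t *: rG (f t)^-1%g = c%:M ->
  \sum_(t : {ffun 'I_m -> T})
     (\prod_(i < m) w (t i)) *: rG (\prod_(i < m) f (t i))%g^-1%g
  = (c ^+ m)%:M.
Proof.
move=> cE; elim: m => [|m IHm].
  have t0 : {ffun 'I_0 -> T} by apply: finfun => -[].
  by rewrite (sum_ffun0 _ t0) !big_ord0 scale1r invg1 repr_mx1 expr0.
rewrite sum_ffunS exchange_big exprS mulrC scalar_mxM -IHm -cE mulmx_suml.
apply: eq_bigr => u _; rewrite mulmx_sumr; apply: eq_bigr => x _.
rewrite !big_ord_recl ffcons0 invMg reprM -scalemxAl -scalemxAr scalerA.
rewrite [in RHS]mulrC; congr (_ * _ *: (rG _^-1%g *m _));
  by apply: eq_bigr => i _; rewrite ffconsS.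
Qed.

End Representation.

(** * The dimension of Hom_G as the trace of an average *)

Section HomDimension.
Variables (R : realType) (G : finGroupType) (X : finType).
Variables (to : {action G &-> X}) (n : nat).
Variable rG : mx_representation R[i] [set: G]%G n.

Local Notation N := #|G|%:R.
Local Notation V := ('Hom('cV[R[i]]_n, {ffun X -> R[i]^o})).

Definition avg_hom (phi : V) : V :=
  N^-1 *: \sum_h
    (linfun (fun_act to h) \o phi \o linfun (col_act rG h^-1%g))%VF.

Lemma avg_homE phi v :
  avg_hom phi v = N^-1 *: \sum_h fun_act to h (phi (col_act rG h^-1%g v)).
Proof.
rewrite scale_lfunE sum_lfunE; congr (_ *: _).
by apply: eq_bigr => h _; rewrite !lfun_simp.
Qed.

Lemma avg_hom_linear : linear avg_hom.
Proof.
move=> a f1 f2; apply/lfunP=> v; rewrite add_lfunE scale_lfunE !avg_homE.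
rewrite scalerA mulrC -scalerA -scalerDr; congr (_ *: _).
rewrite scaler_sumr -big_split; apply: eq_bigr => h _ /=.
by rewrite !lfun_simp linearP.
Qed.

HB.instance Definition _ :=
  GRing.isLinear.Build _ _ _ _ avg_hom avg_hom_linear.

Lemma fun_actM g h (f : {ffun X -> R[i]^o}) :
  fun_act to (g * h)%g f = fun_act to g (fun_act to h f).
Proof. by apply/ffunP=> x; rewrite !ffunE -lactM invMg. Qed.

Lemma col_actM g h v : col_act rG (g * h)%g v = col_act rG g (col_act rG h v).
Proof. by rewrite /col_act reprM mulmxA. Qed.

Lemma avg_hom_in phi : avg_hom phi \in HomG to rG.
Proof.
apply/mem_HomG => x v; rewrite !avg_homE [RHS]linearZ; congr (_ *: _).
rewrite linear_sum.
rewrite (reindex_inj (mulgI x)); apply: eq_bigr => h _ /=.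
by rewrite fun_actM -col_actM invMg mulgKV.
Qed.

Lemma avg_hom_id phi : phi \in HomG to rG -> avg_hom phi = phi.
Proof.
move=> /mem_HomG phiE; apply/lfunP=> v; rewrite avg_homE.
rewrite (eq_bigr (fun=> phi v)) => [|h _].
  rewrite sumr_const -(scaler_nat _ (phi v)) scalerA mulVf ?scale1r //.
  by rewrite pnatr_eq0 -lt0n; apply/card_gt0P; exists 1%g.
by rewrite -phiE -col_actM mulgV /col_act repr_mx1 mul1mx.
Qed.

(** For [p] = (j, x), the matrix unit sending the basis vector e_j to the indicator function of x;
    [hom_coord] is the dual coordinate. *)
Definition entry_delta (p : 'I_n * X) (v : 'cV[R[i]]_n) :
  {ffun X -> R[i]^o} := [ffun y => (y == p.2)%:R * v p.1 0].

Lemma entry_delta_linear p : linear (entry_delta p).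
Proof.
by move=> a u v; apply/ffunP=> x; rewrite !ffunE !mxE mulrDr mulrCA.
Qed.

HB.instance Definition _ p :=
  GRing.isLinear.Build _ _ _ _ (entry_delta p) (entry_delta_linear p).

Definition hom_delta (p : 'I_n * X) : V := linfun (entry_delta p).

Definition hom_coord (p : 'I_n * X) (phi : V) : R[i]^o :=
  phi (delta_mx p.1 0) p.2.

Lemma hom_coord_linear p : linear (hom_coord p).
Proof. by move=> a f g; rewrite /hom_coord !lfun_simp !ffunE. Qed.

HB.instance Definition _ p :=
  GRing.isLinear.Build _ _ _ _ (hom_coord p) (hom_coord_linear p).

Lemma hom_deltaE p v y : hom_delta p v y = (y == p.2)%:R * v p.1 0.
Proof. by rewrite lfunE ffunE. Qed.

Lemma hom_coordK phi : phi = \sum_p hom_coord p phi *: hom_delta p.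
Proof.
apply/lfunP=> v; rewrite sum_lfunE; apply/ffunP=> y; rewrite sum_ffunE.
rewrite -(pair_bigA _ (fun j x =>
  (hom_coord (j, x) phi *: hom_delta (j, x))%VF v y)) /=.
have {1}-> : v = \sum_j v j 0 *: delta_mx j 0.
  rewrite {1}[v]matrix_sum_delta; apply: eq_bigr => j _; exact: big_ord1.
rewrite linear_sum sum_ffunE; apply: eq_bigr => j _.
rewrite linearZ (bigD1 y) //= big1 => [|x xy].
  by rewrite addr0 scale_lfunE !ffunE hom_deltaE eqxx mul1r; apply: mulrC.
by rewrite scale_lfunE ffunE hom_deltaE eq_sym (negPf xy) mul0r; apply: mulr0.
Qed.

(** The diagonal coefficient at (j, x) of phi |-> h phi h^-1 is [rG h^-1 j j] if h fixes x and 0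
    otherwise. *)
Lemma dim_HomG :
  (\dim (HomG to rG))%:R =
  N^-1 * \sum_h #|'Fix_to[h]|%:R * \tr (rG h^-1%g) :> R[i].
Proof.
rewrite (dim_projection avg_hom_in avg_hom_id hom_coordK).
under eq_bigr => p _ do rewrite /= /hom_coord avg_homE ffunE sum_ffunE.
rewrite -scaler_sumr exchange_big; congr (_ * _); apply: eq_bigr => h _.
rewrite -(pair_bigA _ (fun j x => fun_act to h
  (hom_delta (j, x) (col_act rG h^-1%g (delta_mx j 0))) x)) /=.
rewrite mulr_sumr; apply: eq_bigr => j _.
rewrite -sum1_card natr_sum mulr_suml [RHS]big_mkcond /=.
apply: eq_bigr => x _; rewrite ffunE hom_deltaE /=.
rewrite /col_act -colE mxE /lact invgK mul1r.
by case: afix1P => [->|/eqP/negPf->]; rewrite ?eqxx ?mul1r ?mul0r.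
Qed.
End HomDimension.

(** * Counting tuples with the regular character *)

Lemma sum_ffun_pair (V : nmodType) (T1 T2 : finType) (k : nat)
    (F : {ffun 'I_k -> T1 * T2} -> V) :
  \sum_t F t = \sum_(a : {ffun 'I_k -> T1}) \sum_(b : {ffun 'I_k -> T2})
                 F [ffun i => (a i, b i)].
Proof.
pose z (p : {ffun 'I_k -> T1} * {ffun 'I_k -> T2}) :=
  [ffun i => (p.1 i, p.2 i)].
pose u (t : {ffun 'I_k -> T1 * T2}) :=
  ([ffun i => (t i).1], [ffun i => (t i).2]).
rewrite pair_big /= (reindex z) //; exists u => [[a b] _|t _].
  by congr pair; apply/ffunP=> i; rewrite !ffunE.
by apply/ffunP=> i; rewrite !ffunE -surjective_pairing.
Qed.

(** Both sides are the trace of the regular representation, which contains each irreducible with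
    multiplicity its dimension. *)
Lemma char_orthogonality (R : realType) (G : finGroupType) (x : G) :
  \sum_(pi : Irr R G) (rep_dim pi)%:R * rep_char pi x = #|G|%:R *+ (x == 1%g).
Proof.
have C'G : pgroup.pgroup [pchar R[i]]^' [set: G].
  by apply/pnatP; rewrite ?cardG_gt0 // => p _ _; rewrite inE /= pchar_num.
have splitG : group_splitting_field R[i] [set: G]%G.
  exact: group_closure_closed_field.
have <- : \tr (regular_repr R[i] [set: G]%G x) = #|G|%:R *+ (x == 1%g).
  have [-> | ntx] := eqVneq x 1%g.
    by rewrite repr_mx1 mxtrace1 /gcard cardsT.
  (* Translation by [x] other than 1 has no fixed point, so the diagonal vanishes. *)
  rewrite [\tr _]big1 // => i _; rewrite 2!mxE /=.
  rewrite -(inj_eq enum_val_inj) gring_indexK ?groupM ?enum_valP ?inE //.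
  by rewrite eq_mulVg1 mulKg (negbTE ntx).
rewrite (mxtrace_regular_pchar (Irr R G)) ?inE //; apply: eq_bigr => pi _.
by rewrite mulr_natl.
Qed.

Lemma card_afix1E (G : finGroupType) (X : finType) (to : {action G &-> X}) h :
  #|'Fix_to[h]| = (\sum_(x : X) (h \in 'C[x | to]))%N.
Proof.
rewrite -sum1_card big_mkcond; apply: eq_bigr => x _.
by rewrite mem_afix1_lact mem_astab1_lact; case: eqP.
Qed.

Lemma card_Ntuples (K : comNzRingType) (G : finGroupType) (X : finType)
    (to : {action G &-> X}) (g : G) (k m : nat) :
  #|Ntuples to g k m|%:R =
  \sum_(h : {ffun 'I_m -> G}) \sum_(a : {ffun 'I_k -> G})
    \sum_(b : {ffun 'I_k -> G})
      (\prod_(i < m) #|'Fix_to[h i]|%:R)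
      * ((\prod_(i < m) h i) * comm_prod a b == g)%g%:R :> K.
Proof.
pose P (p : {ffun 'I_m -> X}) (h : {ffun 'I_m -> G})
    (a b : {ffun 'I_k -> G}) : K :=
  (\prod_(i < m) (h i \in 'C[p i | to])%:R)
  * ((\prod_(i < m) h i) * comm_prod a b == g)%g%:R.
transitivity (\sum_(p : {ffun 'I_m -> X}) \sum_(h : {ffun 'I_m -> G})
    \sum_(a : {ffun 'I_k -> G}) \sum_(b : {ffun 'I_k -> G}) P p h a b).
  rewrite pair_bigA pair_bigA pair_bigA -sum1_card big_mkcond natr_sum /=.
  apply: eq_bigr => [] [[[p h] a] b] _; rewrite inE /P /=.
  case: ifP => [/andP[/forallP ph ->]|].
    by rewrite big1 ?mulr1 // => i _; rewrite ph.
  move/negbT; rewrite negb_and => /orP[/forallPn[i /negPf ph]|/negPf->].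
    by rewrite (bigD1 i) //= ph !mul0r.
  by rewrite mulr0.
rewrite exchange_big; apply: eq_bigr => h _ /=.
rewrite exchange_big; apply: eq_bigr => a _ /=.
rewrite exchange_big; apply: eq_bigr => b _ /=.
rewrite -mulr_suml; congr (_ * _).
(* The p_i are independent, so the sum over p of a product of indicators is a product of sums. *)
rewrite -(bigA_distr_bigA (fun i x => (h i \in 'C[x | to])%:R)) /=.
by apply: eq_bigr => i _; rewrite card_afix1E natr_sum.
Qed.

Section Scalars.
Variables (R : realType) (G : finGroupType) (n : nat).
Variable rG : mx_representation R[i] [set: G]%G n.
Hypothesis irrG : mx_irreducible rG.
Local Notation N := #|G|%:R.

Lemma sum_afix_repr (X : finType) (to : {action G &-> X}) :
  \sum_h #|'Fix_to[h]|%:R *: rG h^-1%g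
  = (N * (\dim (HomG to rG))%:R / n%:R)%:M.
Proof.
rewrite (sum_class_repr irrG) => [|x y]; last by rewrite card_afix1C.
rewrite dim_HomG mulrA mulfV ?mul1r //.
by rewrite pnatr_eq0 -lt0n; apply/card_gt0P; exists 1%g.
Qed.

Lemma sum_comm_prod_repr k :
  \sum_(a : {ffun 'I_k -> G}) \sum_(b : {ffun 'I_k -> G})
    rG (comm_prod a b)^-1%g = (((N / n%:R) ^+ 2) ^+ k)%:M.
Proof.
(* Tuples of pairs with weight 1; [sum_ffun_pair] separates them into [a] and [b]. *)
rewrite -(@sum_prod_repr _ _ _ rG _ (fun=> 1) (fun p => comm_l p.1 p.2)).
  rewrite sum_ffun_pair; apply: eq_bigr => a _; apply: eq_bigr => b _.
  rewrite big1 // scale1r; congr (rG _^-1%g).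
  by apply: eq_bigr => i _; rewrite ffunE.
by rewrite -(sum_comm_repr irrG); apply: eq_bigr => p _; rewrite scale1r.
Qed.

End Scalars.

Lemma Ntuples_char_sum (R : realType) (G : finGroupType) (X : finType)
    (to : {action G &-> X}) (g : G) (k m : nat) :
  #|G|%:R * #|Ntuples to g k m|%:R =
  \sum_(pi : Irr R G) (rep_dim pi)%:R *
    ((#|G|%:R * (\dim (HomG to (irr_repr pi)))%:R / (rep_dim pi)%:R) ^+ m
     * ((#|G|%:R / (rep_dim pi)%:R) ^+ 2) ^+ k * rep_char pi g) :> R[i].
Proof.
have irrpi (pi : Irr R G) : mx_irreducible (irr_repr pi) by exact: socle_irr.
transitivity (\sum_(h : {ffun 'I_m -> G}) \sum_(a : {ffun 'I_k -> G})
    \sum_(b : {ffun 'I_k -> G}) \sum_(pi : Irr R G)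
      (\prod_(i < m) #|'Fix_to[h i]|%:R) * ((rep_dim pi)%:R * rep_char pi
        (g * ((\prod_(i < m) h i) * comm_prod a b)^-1)%g)).
  rewrite card_Ntuples mulr_sumr; apply: eq_bigr => h _.
  rewrite mulr_sumr; apply: eq_bigr => a _.
  rewrite mulr_sumr; apply: eq_bigr => b _.
  rewrite -mulr_sumr char_orthogonality mulrCA mulr_natr.
  by rewrite -eq_mulgV1 eq_sym.
under eq_bigr => h _.
  under eq_bigr => a _ do rewrite exchange_big.
  rewrite exchange_big.
  over.
rewrite exchange_big; apply: eq_bigr => pi _ /=.
(* For fixed [pi] the trace is linear and the sums over [h] and over [a], [b] separate; the
   commutators come first because of the inversion. *)
transitivity ((rep_dim pi)%:R * \tr (irr_repr pi g *m
  ((\sum_(a : {ffun 'I_k -> G}) \sum_(b : {ffun 'I_k -> G})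
      irr_repr pi (comm_prod a b)^-1%g) *m
   (\sum_(h : {ffun 'I_m -> G}) (\prod_(i < m) #|'Fix_to[h i]|%:R)
      *: irr_repr pi (\prod_(i < m) h i)^-1%g)))); last first.
  rewrite (sum_comm_prod_repr (irrpi pi)).
  rewrite (sum_prod_repr _ (sum_afix_repr (irrpi pi) to)).
  by rewrite -scalar_mxM mul_mx_scalar mxtraceZ [_ ^+ k * _]mulrC.
rewrite mulmx_sumr mulmx_sumr raddf_sum /= mulr_sumr; apply: eq_bigr => h _.
rewrite mulmx_suml mulmx_sumr raddf_sum /= mulr_sumr; apply: eq_bigr => a _.
rewrite mulmx_suml mulmx_sumr raddf_sum /= mulr_sumr; apply: eq_bigr => b _.
rewrite mulrCA; congr (_ * _).
rewrite -!scalemxAr mxtraceZ /rep_char; congr (_ * \tr _).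
by rewrite -!reprM invMg.
Qed.

(* In the last sum, [h : {ffun 'I_m.-1 -> G}] is (h_2, .., h_m). *)
Theorem theorem3p1 (R : realType) (G : finGroupType) (X : finType)
    (to : {action G &-> X}) (g : G) (k m : nat) (m_ge1 : (1 <= m)%N) :
  (\sum_(pi : Irr R G)
      (\dim (HomG to (irr_repr pi)))%:R ^+ m
      / (rep_dim pi)%:R ^+ (m + 2 * k - 1)%N * rep_char pi g
   = (#|[set: G]|%:R ^+ (m + 2 * k - 1)%N)^-1 * #|Ntuples to g k m|%:R :> R[i])
  /\
  ((#|[set: G]|%:R ^+ (m + 2 * k - 1)%N)^-1 * #|Ntuples to g k m|%:R
   = (#|[set: G]|%:R ^+ (m + 2 * k - 1)%N)^-1
     * \sum_(h : {ffun 'I_m.-1 -> G})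
         \sum_(a : {ffun 'I_k -> G}) \sum_(b : {ffun 'I_k -> G})
           #|'Fix_to[g^-1 * (\prod_(i < m.-1) h i) * comm_prod a b]%g|%:R
           * \prod_(i < m.-1) #|'Fix_to[h i]|%:R :> R[i]).
Proof.
case: m m_ge1 => // m _; rewrite cardsT /=; split; last first.
  congr (_ * _); rewrite card_Ntuples sum_ffunS exchange_big.
  apply: eq_bigr => h _; rewrite exchange_big; apply: eq_bigr => a _.
  rewrite exchange_big; apply: eq_bigr => b _ /=.
  set y := (\prod_(i < m) h i)%g; set c := comm_prod a b.
  have prodE x : (\prod_(i < m.+1) ffcons x h i)%g = (x * y)%g.
    rewrite big_ord_recl ffcons0; congr (_ * _)%g.
    by apply: eq_bigr => i _; rewrite ffconsS.
  (* The equation has exactly one solution h_1, namely g (y c)^-1. *)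
  rewrite (bigD1 (g * (y * c)^-1)%g) //= [X in _ + X]big1 => [|x xg].
    rewrite addr0 prodE -mulgA mulgKV eqxx mulr1 big_ord_recl ffcons0.
    congr (_%:R * _); last by apply: eq_bigr => i _; rewrite ffconsS.
    (* Inversion gives y c g^-1, and cyclic invariance moves g^-1 to the front. *)
    by rewrite -card_afix1V !invMg invgK card_afix1C !mulgA.
  rewrite prodE; case: eqP => [xE|]; last by rewrite mulr0.
  by case/eqP: xg; rewrite -xE -(mulgA x) mulgK.
have N0 : #|G|%:R != 0 :> R[i].
  by rewrite pnatr_eq0 -lt0n; apply/card_gt0P; exists 1%g.
apply: (mulfI N0); rewrite mulrCA Ntuples_char_sum !mulr_sumr.
apply: eq_bigr => pi _.
have n0 : (rep_dim pi)%:R != 0 :> R[i].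
  by rewrite pnatr_eq0 -lt0n; case/mx_irrP: (socle_irr pi).
(* Here [m] is the original exponent minus 1, so the truncated subtraction disappears and m + 2k
   remains. One factor [N] and one factor [n] cancel against the (m + 1 + 2k)-th powers from
   [Ntuples_char_sum]. *)
rewrite addSn subn1 /=; set N := #|G|%:R; set n := (rep_dim pi)%:R.
rewrite -exprM !expr_div_n exprMn !exprS !exprD.
by field; rewrite ?n0 ?N0 ?expf_neq0.
Qed.
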